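(* Fix the wave speed $c$, the density $\rho$, the frequency $\omega$, the position $\mathbf{x}_2$, the observation operator $\mathfrak{R}$ and the data vector $\mathbf{d}$, and consider the discretized misfit functional $$J(\mathbf{S})=\tfrac12\big\|\mathfrak{R}\,\mathbf{C}_{\mathbf{S}}-\mathbf{d}\big\|^2$$ as a function of the vector $\mathbf{S}=(\mathbf{S}_e)_{K_e\in\mathcal{T}_h}$ of real coefficients of the source covariance. Here $(\mathbf{C}_{\mathbf{S}},\Lambda_C)$ is the solution of the discrete cross-correlation problem $$\mathbb{A}_e\mathbf{C}_e+\mathbb{D}_e\mathcal{R}_e\Lambda_C=\mathbb{M}_e(\overline{\hat{\mathbf{G}}}_e,\hat{\mathbf{S}}_e)\quad\forall K_e\in\mathcal{T}_h,\qquad \sum_e\mathcal{R}_e^{\mathrm t}\big(\mathbb{B}_e\mathbf{C}_e+\mathbb{L}_e\mathcal{R}_e\Lambda_C\big)=0,$$ and $(\mathbf{G},\Lambda_G)$ is the solution of the discrete Green's function problem $$\mathbb{A}_e\mathbf{G}_e+\mathbb{D}_e\mathcal{R}_e\Lambda_G=\mathbb{P}_e\quad\forall K_e\in\mathcal{T}_h,\qquad \sum_e\mathcal{R}_e^{\mathrm t}\big(\mathbb{B}_e\mathbf{G}_e+\mathbb{L}_e\mathcal{R}_e\Lambda_G\big)=0 .$$ Given $\mathbf{S}$, let the adjoint state $(\boldsymbol{\gamma}_2,\Gamma_2)$, with $\boldsymbol\gamma_2=(\boldsymbol\gamma_{2,e})_{K_e\in\mathcal T_h}$, be the solution of $$\mathbb{A}_e^*\boldsymbol{\gamma}_{2,e}+\mathbb{B}_e^*\mathcal{R}_e\Gamma_2=-\mathfrak{R}_e^*\big(\mathfrak{R}\mathbf{C}_{\mathbf{S}}-\mathbf{d}\big)\quad\forall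 K_e\in\mathcal{T}_h,\qquad \sum_e\mathcal{R}_e^{\mathrm t}\big(\mathbb{D}_e^*\boldsymbol{\gamma}_{2,e}+\mathbb{L}_e^*\mathcal{R}_e\Gamma_2\big)=0 .$$ Then, for every real perturbation $\delta=(\delta_e)_{K_e\in\mathcal{T}_h}$ of $\mathbf{S}$, the derivative of $J$ at $\mathbf{S}$ in the direction $\delta$ is $$D_{\mathbf{S}}J\cdot\delta=-\Re\Big(\sum_{K_e\in\mathcal{T}_h}\big(\mathbb{M}_e(\overline{\hat{\mathbf{G}}}_e,\hat\delta_e),\,\boldsymbol{\gamma}_{2,e}\big)_{\boldsymbol{\Psi}_e}\Big).$$
   Context: Setting. $\Omega\subset\mathbb{R}^{\mathrm d}$ (with $\mathrm d=2$ or $3$) is a bounded domain with simplicial mesh $\mathcal{T}_h=\{K_e\}$ and set of faces $\Sigma$. The boundary of $\Omega$ is split into $\Gamma_{\mathrm{abc}}$ and $\Gamma_{\mathrm d}$. Attenuation is ignored, so $c$ and $\rho$ are real; $\kappa=\rho c^2$ is the bulk modulus, and $\tau$ is a real stabilization parameter on the faces. The components are $\mathrm{comp}=\{p,v_1,\dots,v_{\mathrm d}\}$ (pressure and velocity). Every element $K_e$ carries a real-valued Lagrange basis $\{\varphi_{e,k}\}_{k=1}^{n_e}$ for each component, and every face $\mathfrak f$ carries a real-valued Lagrange basis $\{\xi_{\mathfrak f,k}\}_k$. Spaces. $\boldsymbol\Psi_e=\mathbb{C}^{n_e\times(\mathrm d+1)}$ is the space of local coefficient vectors $\mathbf U_e=(\mathrm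 U_{e,k}^{[i]})_{i\in\mathrm{comp},\,k}$, with inner product $(\mathbf U_e,\mathbf V_e)_{\boldsymbol\Psi_e}=\sum_{i\in\mathrm{comp}}\sum_k \mathrm U^{[i]}_{e,k}\overline{\mathrm V^{[i]}_{e,k}}$, and $\boldsymbol\Psi=(\boldsymbol\Psi_e)_{K_e\in\mathcal T_h}$ is the global space. A hat denotes the function with given coefficients, e.g. $\hat{\mathrm G}^{[p]}_e=\sum_k\mathrm G^{[p]}_{e,k}\varphi_{e,k}$. $\boldsymbol\Lambda$ is the complex space of coefficient vectors $\Lambda$ of a scalar trace unknown $\lambda_h$ on $\Sigma$, with the standard Hermitian inner product. $\mathcal R_e$ is the (real) restriction matrix extracting from $\Lambda$ the coefficients on the faces of $K_e$. Matrices. The local matrices $\mathbb A_e,\mathbb D_e,\mathbb B_e,\mathbb L_e$ come from a Hybridizable Discontinuous Galerkin discretization and do not depend on $\mathbf S$. For $(p_h,\mathbf v_h)$ with coefficients $\mathbf U_e$ and $\lambda_h$ with coefficients $\Lambda$, the entries of $\mathbb A_e\mathbf U_e+\mathbb D_e\mathcal R_e\Lambda$ are, for basis test functions $\varphi$ (pressure block) and $\boldsymbol\psi$ (velocity blocks), $$\mathrm i\omega\int_{K_e}\tfrac1\kappa p_h\varphi-\int_{K_e}(\nabla\cdot\mathbf v_h)\varphi+\int_{\partial K_e}\tau(p_h-\lambda_h)\varphi,\qquad -\mathrm i\omega\int_{K_e}\rho\,\mathbf v_h\cdot\boldsymbol\psi-\int_{K_e}p_h\nabla\cdot\boldsymbol\psi+\int_{\partial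 K_e}\lambda_h\boldsymbol\psi\cdot\mathbf n .$$ The entries of $\mathbb B_e\mathbf U_e+\mathbb L_e\mathcal R_e\Lambda$ are, for face basis functions $\xi$ on a face $\mathfrak f$ of $K_e$ with outward normal $\mathbf n$: $\int_{\mathfrak f}(\mathbf v_h\cdot\mathbf n-\tau(p_h-\lambda_h))\xi$ if $\mathfrak f$ is interior; $\int_{\mathfrak f}(\mathbf v_h\cdot\mathbf n-\tau(p_h-\lambda_h)-\tfrac1{\rho c}\lambda_h)\xi$ if $\mathfrak f\subset\Gamma_{\mathrm{abc}}$; $\int_{\mathfrak f}\lambda_h\xi$ if $\mathfrak f\subset\Gamma_{\mathrm d}$. The matrices $\mathbb A_e$ and the global matrix $\mathbb K=\sum_e\mathcal R_e^{\mathrm t}(\mathbb L_e-\mathbb B_e\mathbb A_e^{-1}\mathbb D_e)\mathcal R_e$ are assumed invertible, so that all the systems have unique solutions. A star denotes the conjugate transpose. Right-hand sides. $\mathbb P_e$ has pressure block $(\varphi_{e,k}(\mathbf x_2))_k$ if $\mathbf x_2\in K_e$ and $0$ otherwise, with zero velocity blocks. The source covariance is represented on $K_e$ by $\hat{\mathbf S}_e=\sum_{m=1}^{n_e^{\mathbf S}}\mathbf S_{e,m}\varphi^{\mathbf S}_{e,m}$ with real coefficients $\mathbf S_e=(\mathbf S_{e,m})_m$ and real-valued Lagrange basis functions $\varphi^{\mathbf S}_{e,m}$; similarly $\hat\delta_e=\sum_m\delta_{e,m}\varphi^{\mathbf S}_{e,m}$. For a function $\hat{\mathbf U}_e$ with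 components in $\mathrm{comp}$ and a scalar function $s$ on $K_e$, $\mathbb M_e(\hat{\mathbf U}_e,s)\in\boldsymbol\Psi_e$ has zero velocity blocks and pressure block with entries $\int_{K_e}s\,\hat{\mathrm U}_e^{[p]}\,\varphi_{e,l}$, $l=1,\dots,n_e$. In particular $\mathbb M_e(\overline{\hat{\mathbf G}}_e,s)$ has entries $\int_{K_e}s\,\overline{\hat{\mathrm G}^{[p]}_e}\,\varphi_{e,l}$. Observation. $\mathfrak R$ is a linear map from $\boldsymbol\Psi$ to a finite-dimensional complex Euclidean space (evaluation of selected components at the receiver positions), $\mathbf d$ is a fixed vector of that space, and $\|\cdot\|$ is the Euclidean norm. $\mathfrak R_e$ is the restriction of $\mathfrak R$ to $\boldsymbol\Psi_e$, so $\mathfrak R\mathbf C=\sum_e\mathfrak R_e\mathbf C_e$. *)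

(* Defs.v *)
From HB Require Import structures.
From mathcomp Require Import all_boot all_order all_algebra.
From mathcomp Require Import all_classical all_reals all_analysis.
From mathcomp Require Import complex.
Set Implicit Arguments.
Unset Strict Implicit.
Unset Printing Implicit Defensive.
Import Order.TTheory GRing.Theory Num.Theory numFieldNormedType.Exports.
Local Open Scope classical_set_scope.
Local Open Scope ring_scope.

Section lebesgue_cons.
Context {R : realType} (n : nat).
Notation T := (measurableTypeR R).
Variable mu : {sigma_finite_measure set (n.-tuple T) -> \bar R}.

Definition tuple_cons (p : T * n.-tuple T) : n.+1.-tuple T :=
  [tuple of p.1 :: p.2].

Lemma measurable_tuple_cons : measurable_fun [set: T * n.-tuple T] tuple_cons.
Proof. exact: measurable_cons. Qed.

Definition lebesgue_cons : set (n.+1.-tuple T) -> \bar R :=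
  pushforward (@lebesgue_measure R \x mu)%E tuple_cons.

Let mtc A : measurable A -> measurable (tuple_cons @^-1` A).
Proof.
by move=> mA; rewrite -[X in measurable X]setTI; exact: measurable_tuple_cons.
Qed.

Let lebesgue_cons0 : lebesgue_cons set0 = 0%E.
Proof. by rewrite /lebesgue_cons /pushforward preimage_set0 measure0. Qed.

Let lebesgue_cons_ge0 A : (0 <= lebesgue_cons A)%E.
Proof. by rewrite /lebesgue_cons /pushforward measure_ge0. Qed.

Let lebesgue_cons_sigma_additive : semi_sigma_additive lebesgue_cons.
Proof.
move=> F mF tF mUF; rewrite /lebesgue_cons /pushforward preimage_bigcup.
apply: measure_semi_sigma_additive.
- by move=> i; exact: mtc.
- apply/trivIsetP => /= i j _ _ ij; rewrite -preimage_setI.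
  by move/trivIsetP : tF => /(_ _ _ _ _ ij) ->//; rewrite preimage_set0.
- by rewrite -preimage_bigcup; exact: mtc.
Qed.

HB.instance Definition _ := isMeasure.Build _ _ _ lebesgue_cons
  lebesgue_cons0 lebesgue_cons_ge0 lebesgue_cons_sigma_additive.

Let lebesgue_cons_sigma_finite : sigma_finite setT lebesgue_cons.
Proof.
have /sigma_finiteP[F [TF ndF Foo]] := sigma_finiteT (@lebesgue_measure R).
have /sigma_finiteP[G [TG ndG Goo]] := sigma_finiteT mu.
pose uncons (t : n.+1.-tuple T) : T * n.-tuple T := (thead t, [tuple of behead t]).
have unconsK p : uncons (tuple_cons p) = p.
  by case: p => x t; congr pair; apply: val_inj.
have mu' : measurable_fun [set: n.+1.-tuple T] uncons.
  by apply: measurable_fun_pair;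
    [exact: measurable_tnth|exact: measurable_behead].
exists (fun i => uncons @^-1` (F i `*` G i)).
  rewrite -preimage_bigcup; apply/esym; rewrite -subTset => t _ /=.
  have [i _ Fi] : (\bigcup_i F i) (uncons t).1 by rewrite -TF.
  have [j _ Gj] : (\bigcup_i G i) (uncons t).2 by rewrite -TG.
  exists (maxn i j) => //; split.
  - by move: Fi; exact/subsetPset/ndF/leq_maxl.
  - by move: Gj; exact/subsetPset/ndG/leq_maxr.
move=> i; have [mFi Fioo] := Foo i; have [mGi Gioo] := Goo i; split.
  by rewrite -[X in measurable X]setTI; apply: mu' => //; exact: measurableX.
rewrite /lebesgue_cons /pushforward -comp_preimage.
rewrite (_ : uncons \o tuple_cons = id); last exact/funext.
by rewrite preimage_id product_measure1E// lte_mul_pinfty// ge0_fin_numE.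
Qed.

HB.instance Definition _ := Measure_isSigmaFinite.Build _ _ _ lebesgue_cons
  lebesgue_cons_sigma_finite.

End lebesgue_cons.

(* Lebesgue measure on R^n: the iterated product measure, carried by tuples, for
   which the library provides a sigma-algebra (it provides none for rows). *)
Fixpoint lebesgue_tuple (R : realType) (n : nat) :
    {sigma_finite_measure set (n.-tuple (measurableTypeR R)) -> \bar R} :=
  if n is m.+1 then lebesgue_cons (lebesgue_tuple R m)
  else \d_ [tuple].

Section geometry.
Context {R : realType}.

Definition row_of_tuple n (t : n.-tuple R) : 'rV[R]_n := \row_i tnth t i.

Definition volint n (D : set 'rV[R]_n) (g : 'rV[R]_n -> R) : R :=
  \int[lebesgue_tuple R n]_(t in @row_of_tuple n @^-1` D) g (row_of_tuple t).

Definition ref_simplex n : set 'rV[R]_n :=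
  [set t | (forall i, 0 <= t 0 i) /\ \sum_i t 0 i <= 1].

Definition edge_mx m n (v : 'I_m.+1 -> 'rV[R]_n) : 'M[R]_(m, n) :=
  \matrix_(i < m) (v (lift ord0 i) - v ord0).

(* The integral of g over the m-simplex with vertices v in R^n, for the
   m-dimensional surface measure: pullback along the affine parametrization
   t |-> v_0 + t E, whose area factor is the square root of det (E E^T). *)
Definition surfint m n (v : 'I_m.+1 -> 'rV[R]_n) (g : 'rV[R]_n -> R) : R :=
  Num.sqrt (\det (edge_mx v *m (edge_mx v)^T)) *
  volint (@ref_simplex m) (fun t => g (v ord0 + t *m edge_mx v)).

Definition conv_hull n (A : set 'rV[R]_n) : set 'rV[R]_n :=
  [set x | exists (k : nat) (v : 'I_k -> 'rV[R]_n) (a : 'I_k -> R),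
    [/\ forall i, A (v i), forall i, 0 <= a i, \sum_i a i = 1 &
        x = \sum_i a i *: v i] ].

Definition simplex m n (v : 'I_m -> 'rV[R]_n) : set 'rV[R]_n :=
  conv_hull (range v).

Definition boundary (T : topologicalType) (A : set T) : set T :=
  closure A `\` interior A.

(* f is a polynomial function of total degree at most p. *)
Definition poly_fun n (p : nat) (f : 'rV[R]_n -> R) : Prop :=
  exists a : {ffun 'I_n -> 'I_p.+1} -> R, forall x,
    f x = \sum_(m : {ffun 'I_n -> 'I_p.+1} | (\sum_i m i <= p)%N)
            a m * \prod_i x 0 i ^+ m i.

(* The Lagrange basis of the polynomials of degree at most [lag_deg] on K, for
   the nodes [lag_node]. The basis functions are polynomials on the whole
   space, of which only the restrictions to K matter. *)
Record lagrange n (K : set 'rV[R]_n) := Lagrange {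
  lag_deg : nat;
  lag_size : nat;
  lag_node : 'I_lag_size -> 'rV[R]_n;
  lag_fun :> 'I_lag_size -> 'rV[R]_n -> R;
  lag_node_in : forall k, K (lag_node k);
  lag_poly : forall k, poly_fun lag_deg (lag_fun k);
  lag_nodal : forall j k, lag_fun k (lag_node j) = (j == k)%:R;
  lag_span : forall f, poly_fun lag_deg f ->
    forall x, K x -> f x = \sum_k f (lag_node k) * lag_fun k x }.

(* The space dimension is d = n.+1. The l-th local face of an element is the one
   opposite to its l-th vertex. The last three fields determine [normal e l] as
   the outward unit normal of e on its l-th face. *)
Record mesh n (Omega : set 'rV[R]_n.+1) := Mesh {
  elt : finType;
  face : finType;
  evtx : elt -> 'I_n.+2 -> 'rV[R]_n.+1;
  fvtx : face -> 'I_n.+1 -> 'rV[R]_n.+1;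
  eface : elt -> 'I_n.+2 -> face;
  normal : elt -> 'I_n.+2 -> 'rV[R]_n.+1;
  evtx_nondegenerate : forall e, \det (edge_mx (evtx e)) != 0;
  elt_inj : forall e e', range (evtx e) = range (evtx e') -> e = e';
  face_inj : forall f f', range (fvtx f) = range (fvtx f') -> f = f';
  eface_vtx : forall e l,
    range (fvtx (eface e l)) = evtx e @` [set i | i != l];
  eface_surj : forall f, exists e l, eface e l = f;
  mesh_conforming : forall e e',
    simplex (evtx e) `&` simplex (evtx e') =
    conv_hull (range (evtx e) `&` range (evtx e'));
  mesh_cover : Omega = interior (\bigcup_(e in [set: elt]) simplex (evtx e));
  normal_unit : forall e l, \sum_j normal e l 0 j ^+ 2 = 1;
  normal_orth : forall e l i i', i != l -> i' != l ->
    \sum_j normal e l 0 j * (evtx e i 0 j - evtx e i' 0 j) = 0;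
  normal_outward : forall e l i, i != l ->
    \sum_j normal e l 0 j * (evtx e l 0 j - evtx e i 0 j) < 0 }.

Definition bounded_domain n (Omega : set 'rV[R]_n) : Prop :=
  [/\ open Omega, connected Omega, Omega !=set0 & bounded_set Omega].

(* A boundary face lies in exactly one of the two parts; an interior face, which
   is not contained in the boundary of Omega, lies in neither. *)
Definition boundary_split n (Omega : set 'rV[R]_n.+1) (T : mesh Omega)
    (Gabc Gd : set 'rV[R]_n.+1) : Prop :=
  Gabc `|` Gd = boundary Omega /\
  forall f : face T, simplex (fvtx f) `<=` boundary Omega ->
    (simplex (fvtx f) `<=` Gabc /\ ~ simplex (fvtx f) `<=` Gd) \/
    (simplex (fvtx f) `<=` Gd /\ ~ simplex (fvtx f) `<=` Gabc).

(* Each element carries a single scalar basis, used for all d + 1 components. *)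
Record hdg_bases n (Omega : set 'rV[R]_n.+1) (T : mesh Omega) := HdgBases {
  ebasis : forall e : elt T, lagrange (simplex (evtx e));
  fbasis : forall f : face T, lagrange (simplex (fvtx f));
  sbasis : forall e : elt T, lagrange (simplex (evtx e)) }.

(* Real data, without any sign or regularity condition. *)
Record medium n (Omega : set 'rV[R]_n.+1) (T : mesh Omega) := Medium {
  wave_speed : 'rV[R]_n.+1 -> R;
  density : 'rV[R]_n.+1 -> R;
  frequency : R;
  stabilization : face T -> 'rV[R]_n.+1 -> R }.

End geometry.

Section indexed.
Context {K : Type}.

Definition vec (I : finType) := 'cV[K]_#|I|.
Definition mat (I J : finType) := 'M[K]_(#|I|, #|J|).
Definition vec_of (I : finType) (f : I -> K) : vec I :=
  \col_r f (enum_val r).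
Definition coef (I : finType) (u : vec I) (i : I) : K := u (enum_rank i) 0.
Definition mat_of (I J : finType) (f : I -> J -> K) : mat I J :=
  \matrix_(r, c) f (enum_val r) (enum_val c).

End indexed.
Arguments vec : clear implicits.
Arguments mat : clear implicits.

Definition conj_trmx (C : numClosedFieldType) m n (A : 'M[C]_(m, n)) :
    'M[C]_(n, m) :=
  map_mx Num.conj A^T.

Definition euclid_norm {R : realType} q (v : 'cV[R[i]]_q) : R :=
  Num.sqrt (\sum_i (complex.Re (v i 0) ^+ 2 + complex.Im (v i 0) ^+ 2)).

Section hdg.
Context {R : realType} {n : nat} {Omega : set 'rV[R]_n.+1}.
Context (T : mesh Omega) (Gabc Gd : set 'rV[R]_n.+1).
Context (bas : hdg_bases T) (med : medium T).
Local Notation C := R[i].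
Local Notation pt := 'rV[R]_n.+1.
Local Notation d := n.+1.
Local Notation "r %:C" := (r%:C)%C : ring_scope.

Implicit Types (e : elt T) (l : 'I_n.+2).

(* [None] is the pressure p and [Some j] the velocity component v_j. *)
Definition component : finType := option 'I_d.

Definition elt_dof e : finType :=
  (component * 'I_(lag_size (ebasis bas e)))%type.
Definition state_dof : finType := {e : elt T & elt_dof e}.
Definition trace_dof : finType :=
  {f : face T & 'I_(lag_size (fbasis bas f))}.
Definition elt_trace_dof e : finType :=
  {l : 'I_n.+2 & 'I_(lag_size (fbasis bas (eface e l)))}.
Definition source_dof : finType :=
  {e : elt T & 'I_(lag_size (sbasis bas e))}.

Definition loc (U : vec C state_dof) e : vec C (elt_dof e) :=
  vec_of (fun i : elt_dof e => coef U (Tagged elt_dof i)).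

Definition int_elt e (g : pt -> R) : R := volint (simplex (evtx e)) g.

Definition int_eltC e (g : pt -> C) : C :=
  (int_elt e (fun x => complex.Re (g x)) +i*
   int_elt e (fun x => complex.Im (g x)))%C.

Definition int_face e l (g : pt -> R) : R := surfint (fvtx (eface e l)) g.

Definition pderiv (j : 'I_d) (f : pt -> R) : pt -> R :=
  fun x => 'D_(delta_mx 0 j) f x.

Definition kappa (x : pt) : R := density med x * wave_speed med x ^+ 2.

Local Notation omega := (frequency med).
Local Notation rho := (density med).
Local Notation tau e l := (stabilization med (eface e l)).

(* The local variational forms. Here (U None, U (Some j)) stands for
   (p_h, v_h) and [lam l] for the restriction of lambda_h to the l-th face. *)
Definition pressure_form e (U : component -> pt -> R) (lam : 'I_n.+2 -> pt -> R)
    (phi : pt -> R) : C :=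
  'i%C * omega%:C *
    (int_elt e (fun x => (kappa x)^-1 * U None x * phi x))%:C
  - (int_elt e (fun x => (\sum_j pderiv j (U (Some j)) x) * phi x))%:C
  + (\sum_l int_face e l
       (fun x => tau e l x * (U None x - lam l x) * phi x))%:C.

Definition velocity_form e (U : component -> pt -> R) (lam : 'I_n.+2 -> pt -> R)
    (psi : 'I_d -> pt -> R) : C :=
  - ('i%C * omega%:C *
      (int_elt e (fun x => rho x * \sum_j U (Some j) x * psi j x))%:C)
  - (int_elt e (fun x => U None x * \sum_j pderiv j (psi j) x))%:C
  + (\sum_l int_face e l
       (fun x => lam l x * \sum_j psi j x * normal e l 0 j))%:C.

Definition trace_form e (U : component -> pt -> R) (lam : 'I_n.+2 -> pt -> R)
    l (xi : pt -> R) : C :=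
  let flux x := \sum_j U (Some j) x * normal e l 0 j
                - tau e l x * (U None x - lam l x) in
  let F := simplex (fvtx (eface e l)) in
  (if `[< F `<=` Gd >] then int_face e l (fun x => lam l x * xi x)
   else if `[< F `<=` Gabc >] then
     int_face e l
       (fun x => (flux x - (rho x * wave_speed med x)^-1 * lam l x) * xi x)
   else int_face e l (fun x => flux x * xi x))%:C.

Definition elt_form e (U : component -> pt -> R) (lam : 'I_n.+2 -> pt -> R)
    (test : elt_dof e) : C :=
  let phi := ebasis bas e test.2 in
  if test.1 is Some i
  then velocity_form e U lam (fun j => if j == i then phi else cst 0)
  else pressure_form e U lam phi.

Definition elt_fun e (k : elt_dof e) : component -> pt -> R :=
  fun i => if i == k.1 then ebasis bas e k.2 else cst 0.

Definition trace_fun e (k : elt_trace_dof e) : 'I_n.+2 -> pt -> R :=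
  fun l => if l == tag k then fbasis bas (eface e (tag k)) (tagged k)
           else cst 0.

(* The forms are linear in ((p_h, v_h), lambda_h): the columns of the matrices
   are their values at the basis functions. *)
Definition A_ e : mat C (elt_dof e) (elt_dof e) :=
  mat_of (fun i k => elt_form (elt_fun k) (cst (cst 0)) i).

Definition D_ e : mat C (elt_dof e) (elt_trace_dof e) :=
  mat_of (fun i k => elt_form (cst (cst 0)) (trace_fun k) i).

Definition B_ e : mat C (elt_trace_dof e) (elt_dof e) :=
  mat_of (fun i k => trace_form e (elt_fun k) (cst (cst 0))
            (tag i) (fbasis bas (eface e (tag i)) (tagged i))).

Definition L_ e : mat C (elt_trace_dof e) (elt_trace_dof e) :=
  mat_of (fun i k => trace_form e (cst (cst 0)) (trace_fun k)
            (tag i) (fbasis bas (eface e (tag i)) (tagged i))).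

Definition trace_glob e (k : elt_trace_dof e) : trace_dof :=
  Tagged (fun f => 'I_(lag_size (fbasis bas f))) (tagged k).

Definition R_ e : mat C (elt_trace_dof e) trace_dof :=
  mat_of (fun k g => (trace_glob k == g)%:R).

Definition K_ : mat C trace_dof trace_dof :=
  \sum_e (R_ e)^T *m (L_ e - B_ e *m invmx (A_ e) *m D_ e) *m R_ e.

Definition hdg_invertible : Prop :=
  (forall e, A_ e \in unitmx) /\ K_ \in unitmx.

Definition hdg_solution (F : forall e, vec C (elt_dof e))
    (U : vec C state_dof) (Lam : vec C trace_dof) : Prop :=
  (forall e, A_ e *m loc U e + D_ e *m (R_ e *m Lam) = F e) /\
  \sum_e (R_ e)^T *m (B_ e *m loc U e + L_ e *m (R_ e *m Lam)) = 0.

Definition hat e (U : vec C (elt_dof e)) (i : component) : pt -> C :=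
  fun x => \sum_k coef U (i, k) * (ebasis bas e k x)%:C.

Definition hat_conj e (U : vec C (elt_dof e)) (i : component) : pt -> C :=
  fun x => Num.conj (hat U i x).

Definition hat_source (S : vec R source_dof) e : pt -> R :=
  fun x => \sum_m coef S (Tagged (fun e => 'I_(lag_size (sbasis bas e))) m)
                  * sbasis bas e m x.

(* K_e is the closed simplex. *)
Definition P_ (x2 : pt) e : vec C (elt_dof e) :=
  vec_of (fun k : elt_dof e =>
    if (k.1 == None) && `[< simplex (evtx e) x2 >]
    then (ebasis bas e k.2 x2)%:C else 0).

Definition M_ e (U : component -> pt -> C) (s : pt -> R) : vec C (elt_dof e) :=
  vec_of (fun k : elt_dof e =>
    if k.1 == None
    then int_eltC e (fun x => (s x)%:C * U None x * (ebasis bas e k.2 x)%:C)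
    else 0).

Definition green_solution (x2 : pt) (G : vec C state_dof)
    (LG : vec C trace_dof) : Prop :=
  hdg_solution (P_ x2) G LG.

Definition correlation_solution (G : vec C state_dof) (S : vec R source_dof)
    (U : vec C state_dof) (LU : vec C trace_dof) : Prop :=
  hdg_solution (fun e => M_ e (hat_conj (loc G e)) (hat_source S e)) U LU.

(* The restriction of the observation operator to the unknowns of e. *)
Definition elt_obs q (obs : 'M[C]_(q, #|state_dof|)) e :
    'M[C]_(q, #|elt_dof e|) :=
  \matrix_(i, k) obs i (enum_rank (Tagged elt_dof (enum_val k))).

Definition adjoint_solution q (obs : 'M[C]_(q, #|state_dof|)) (res : 'cV[C]_q)
    (gam : vec C state_dof) (Gam : vec C trace_dof) : Prop :=
  (forall e, conj_trmx (A_ e) *m loc gam e + conj_trmx (B_ e) *m (R_ e *m Gam)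
             = - (conj_trmx (elt_obs obs e) *m res)) /\
  \sum_e (R_ e)^T *m (conj_trmx (D_ e) *m loc gam e
                      + conj_trmx (L_ e) *m (R_ e *m Gam)) = 0.

Definition dot_elt e (U V : vec C (elt_dof e)) : C :=
  \sum_i \sum_k coef U (i, k) * Num.conj (coef V (i, k)).

Definition misfit q (obs : 'M[C]_(q, #|state_dof|)) (dat : 'cV[C]_q)
    (U : vec C state_dof) : R :=
  2^-1 * euclid_norm (obs *m U - dat) ^+ 2.

End hdg.

(* Main.v *)
(** The volume integrals of polynomials over the nondegenerate simplices of the
    mesh are finite, so the right-hand side of the correlation problem is
    real-linear in the source, and by unique solvability
    C_(S + h delta) = C_S + h C_delta for real h. Hence the misfit is a quadratic
    polynomial in h, with linear coefficient Re (R C_S - d)^* (R C_delta).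
    Pairing the equations for C_delta with the adjoint state, the trace terms
    cancel against the two transmission conditions, and this coefficient becomes
    - Re sum_e (M_e(conj G, delta), gamma_2). *)

Require Import Defs.
From mathcomp Require Import all_boot all_order all_algebra.
From mathcomp Require Import all_classical all_reals all_analysis.
From mathcomp Require Import complex measurable_realfun ring.
Set Implicit Arguments.
Unset Strict Implicit.
Unset Printing Implicit Defensive.
Import Order.TTheory GRing.Theory Num.Theory numFieldNormedType.Exports.
Local Open Scope classical_set_scope.
Local Open Scope ring_scope.

(** * Integrability of polynomials over nondegenerate simplices, and linearity of [volint] there *)

Section volume_integral.
Context {R : realType}.

(** The closed ball of the sup norm. Being a product of intervals, it is adapted to the iterated
    product measure, and serves as a container of finite measure for the simplices. *)
Definition cube n (B : R) : set 'rV[R]_n := [set x | forall i, `|x 0 i| <= B].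

Lemma cube_tuple_cons n B :
  @tuple_cons R n @^-1` (@row_of_tuple R n.+1 @^-1` cube B) =
  `[- B, B] `*` (@row_of_tuple R n @^-1` cube B).
Proof.
apply/seteqP; split => -[x t] /=; rewrite /cube /= in_itv /= -ler_norml.
  move=> h; split; first by have := h ord0; rewrite mxE /tuple_cons tnth0.
  by move=> i; have := h (lift ord0 i); rewrite !mxE /tuple_cons tnthS.
move=> [hx ht] i; case: (unliftP ord0 i) => [j|] ->; rewrite mxE /tuple_cons.
  by rewrite tnthS; have := ht j; rewrite mxE.
by rewrite tnth0.
Qed.

Lemma measurable_cube n B :
  measurable (@row_of_tuple R n @^-1` cube B : set (n.-tuple (measurableTypeR R))).
Proof.
rewrite (_ : _ @^-1` _ = \bigcap_(i in [set: 'I_n])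
   (@tnth n (measurableTypeR R) ^~ i @^-1` `[- B, B])); last first.
  apply/seteqP; split => t /=; rewrite /cube /=.
    by move=> h i _ /=; rewrite in_itv /= -ler_norml; have := h i; rewrite mxE.
  by move=> h i; have := h i I; rewrite /= in_itv /= -ler_norml mxE.
apply: fin_bigcap_measurable => // i _.
by rewrite -[X in measurable X]setTI; exact: measurable_tnth.
Qed.

(** Induction on the dimension: each step multiplies by the finite length of one interval, starting
    from a Dirac mass in dimension 0. *)
Lemma lebesgue_cube_lty n B :
  (lebesgue_tuple R n (@row_of_tuple R n @^-1` cube B) < +oo)%E.
Proof.
elim: n => [|n IH] /=.
  by rewrite diracE ltey; case: (_ \in _).
rewrite /lebesgue_cons /pushforward cube_tuple_cons product_measure1E//;
  last exact: measurable_cube.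
apply: lte_mul_pinfty => //.
have := lebesgue_measure_itv `[- B, B] => /= ->; case: ifPn => // _.
Qed.

(** A class of integrands closed under sums and products, containing the polynomials, and integrable
    on bounded measurable sets. Measurability is expressed on tuples because [lebesgue_tuple] lives
    there. *)
Definition regular n (g : 'rV[R]_n -> R) : Prop :=
  measurable_fun [set: n.-tuple (measurableTypeR R)] (g \o @row_of_tuple R n) /\
  forall B, exists M, forall x, cube B x -> `|g x| <= M.

Lemma regular_cst n c : regular (fun _ : 'rV[R]_n => c).
Proof. by split=> [|B]; [exact: measurable_cst|exists `|c|]. Qed.

Lemma regular_coord n j : regular (fun x : 'rV[R]_n => x 0 j).
Proof.
split=> [|B]; last by exists B => x; exact.
rewrite (_ : _ \o _ = @tnth n (measurableTypeR R) ^~ j); first exact: measurable_tnth.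
by apply/funext => t /=; rewrite mxE.
Qed.

Lemma regularD n (f g : 'rV[R]_n -> R) : regular f -> regular g -> regular (fun x => f x + g x).
Proof.
move=> [mf bf] [mg bg]; split=> [|B]; first exact: measurable_funD.
have [Mf hf] := bf B; have [Mg hg] := bg B; exists (Mf + Mg) => x Bx.
by rewrite (le_trans (ler_normD _ _))// lerD ?hf ?hg.
Qed.

Lemma regularM n (f g : 'rV[R]_n -> R) : regular f -> regular g -> regular (fun x => f x * g x).
Proof.
move=> [mf bf] [mg bg]; split=> [|B]; first exact: measurable_funM.
have [Mf hf] := bf B; have [Mg hg] := bg B; exists (Mf * Mg) => x Bx.
by rewrite normrM ler_pM ?hf ?hg.
Qed.

Lemma regular_sum n (I : Type) (r : seq I) (P : pred I) (f : I -> 'rV[R]_n -> R) :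
  (forall i, regular (f i)) -> regular (fun x => \sum_(i <- r | P i) f i x).
Proof.
move=> h; elim: r => [|i r IH].
  by under eq_fun do rewrite big_nil; exact: regular_cst.
under eq_fun do rewrite big_cons; case: (P i) => //.
exact: regularD.
Qed.

Lemma regular_prod n (I : Type) (r : seq I) (P : pred I) (f : I -> 'rV[R]_n -> R) :
  (forall i, regular (f i)) -> regular (fun x => \prod_(i <- r | P i) f i x).
Proof.
move=> h; elim: r => [|i r IH].
  by under eq_fun do rewrite big_nil; exact: regular_cst.
under eq_fun do rewrite big_cons; case: (P i) => //.
exact: regularM.
Qed.

Lemma regularX n (f : 'rV[R]_n -> R) k : regular f -> regular (fun x => f x ^+ k).
Proof.
move=> h; elim: k => [|k IH].
  by under eq_fun do rewrite expr0; exact: regular_cst.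
by under eq_fun do rewrite exprS; exact: regularM.
Qed.

Lemma regular_poly_fun n p (f : 'rV[R]_n -> R) : poly_fun p f -> regular f.
Proof.
move=> [a /funext ->]; apply: regular_sum => m; apply: regularM.
  exact: regular_cst.
by apply: regular_prod => i; apply/regularX/regular_coord.
Qed.

(** Inverting the edge matrix gives the barycentric coordinates of the vertices other than [v ord0],
    whose weight is one minus their sum. The existential convex hull thus becomes a finite system of
    affine inequalities, from which measurability can be read. *)
Lemma simplexE n (v : 'I_n.+1 -> 'rV[R]_n) : \det (edge_mx v) != 0 ->
  simplex v = [set x | ref_simplex ((x - v ord0) *m invmx (edge_mx v))].
Proof.
move=> hdet; have uE : edge_mx v \in unitmx by rewrite unitmxE unitfE.
have bary (b : 'rV[R]_n) : v ord0 + b *m edge_mx v =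
    (1 - \sum_i b 0 i) *: v ord0 + \sum_i b 0 i *: v (lift ord0 i).
  rewrite mulmx_sum_row scalerBl scale1r -addrA; congr (_ + _).
  rewrite scaler_suml -sumrN -big_split /=; apply: eq_bigr => i _.
  rewrite (_ : row i _ = v (lift ord0 i) - v ord0); last by apply/rowP => j; rewrite !mxE.
  by rewrite scalerBr addrC.
apply/seteqP; split => x.
  move=> [k [w [a [hw a0 a1 ->]]]].
  have [s hs] : exists s : 'I_k -> 'I_n.+1, forall i, w i = v (s i).
    have /choice[s hs] : forall i, exists j, w i = v j.
      by move=> i; have [j _ <-] := hw i; exists j.
    by exists s.
  (* A convex combination may list a vertex several times or omit it, so the weights are gathered
     vertex by vertex. *)
  pose b := \row_i \sum_(j | s j == lift ord0 i) a j : 'rV[R]_n.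
  (* The regrouping is stated for an arbitrary module since it is used twice: with the constant 1
     for the total weight, and with [v] for the point itself. *)
  have sumb (V : lmodType R) (u : 'I_n.+1 -> V) : \sum_j a j *: u (s j) =
      (\sum_(j | s j == ord0) a j) *: u ord0 +
      \sum_i b 0 i *: u (lift ord0 i).
    rewrite (partition_big s predT) //= big_ord_recl; congr (_ + _).
      by rewrite scaler_suml; apply: eq_bigr => j /eqP ->.
    apply: eq_bigr => i _; rewrite mxE scaler_suml.
    by apply: eq_bigr => j /eqP ->.
  have hb : \sum_(j | s j == ord0) a j = 1 - \sum_i b 0 i.
    have := sumb R^o (fun=> 1).
    rewrite -scaler_suml -scaler_suml a1 => /(congr1 (fun z : R => z - \sum_i b 0 i)).
    by rewrite /GRing.scale /= !mulr1 addrK.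
  have -> : \sum_j a j *: w j = v ord0 + b *m edge_mx v.
    by rewrite bary -hb -sumb; apply: eq_bigr => j _; rewrite hs.
  rewrite /= addrAC subrr add0r mulmxK//; split=> [i|].
    by rewrite mxE sumr_ge0.
  by rewrite -subr_ge0 -hb sumr_ge0.
move=> [b0 b1]; set b := _ *m _ in b0 b1.
have -> : x = v ord0 + b *m edge_mx v by rewrite /b mulmxKV// addrC subrK.
(* Conversely, each vertex is listed once; [unlift] returns [None] exactly at [ord0], which receives
   the remaining weight. *)
exists n.+1, v, (fun i => if unlift ord0 i is Some j then b 0 j else 1 - \sum_i b 0 i).
split.
- by move=> i; exists i.
- by move=> i; case: unliftP => [j _|_] //; rewrite subr_ge0.
- rewrite big_ord_recl unlift_none -[RHS](subrK (\sum_i b 0 i)); congr (_ + _).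
  by apply: eq_bigr => i _; rewrite liftK.
- rewrite big_ord_recl unlift_none bary; congr (_ + _).
  by apply: eq_bigr => i _; rewrite liftK.
Qed.

Lemma simplex_sub_cube n m (v : 'I_m -> 'rV[R]_n) :
  exists B, simplex v `<=` cube B.
Proof.
exists (\sum_j \sum_i `|v j 0 i|) => x [k [w [a [hw a0 a1 ->]]]] i.
rewrite summxE (le_trans (ler_norm_sum _ _ _))//.
rewrite -[leRHS]mul1r -a1 mulr_suml ler_sum// => j _.
rewrite mxE normrM ger0_norm// ler_wpM2l//.
(* The crude bound adds up the absolute values of all coordinates of all vertices, so the required
   coordinate is one of its terms. *)
have [l _ <-] := hw j; rewrite (bigD1 l)//= (bigD1 i)//= -addrA lerDl.
by rewrite addr_ge0// sumr_ge0// => *; rewrite ?sumr_ge0.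
Qed.

Lemma measurable_simplex n (v : 'I_n.+1 -> 'rV[R]_n) : \det (edge_mx v) != 0 ->
  measurable (@row_of_tuple R n @^-1` simplex v : set (n.-tuple (measurableTypeR R))).
Proof.
move=> /simplexE ->; set b := fun x : 'rV_n => (x - v ord0) *m invmx (edge_mx v).
have rb i : regular (fun x => b x 0 i).
  under eq_fun do rewrite /b mxE; apply: regular_sum => j.
  apply: regularM; last exact: regular_cst.
  under eq_fun do rewrite mxE; apply: regularD; last exact: regular_cst.
  exact: regular_coord.
have le_meas f g : regular f -> regular g ->
    measurable ([set t | f (row_of_tuple t) <= g (row_of_tuple t)]
      : set (n.-tuple (measurableTypeR R))).
  move=> [mf _] [mg _]; rewrite -[X in measurable X]setTI.
  exact: measurable_fun_le.
rewrite (_ : _ @^-1` _ = (\bigcap_(i in [set: 'I_n])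
    [set t : n.-tuple (measurableTypeR R) | 0 <= b (row_of_tuple t) 0 i]) `&`
    [set t : n.-tuple (measurableTypeR R) | \sum_i b (row_of_tuple t) 0 i <= 1]).
  apply: measurableI; first apply: fin_bigcap_measurable => // i _.
    exact: (le_meas _ _ (regular_cst _ 0) (rb i)).
  exact: (le_meas (fun x => \sum_i b x 0 i) _ (regular_sum _ _ rb) (regular_cst _ 1)).
by apply/seteqP; split => t /= [h1 h2]; split => // i *; exact: h1.
Qed.

(** The simplex is measurable and sits in a cube, so it has finite measure, and [g] is measurable
    and bounded on it. *)
Lemma simplex_integrable n (v : 'I_n.+1 -> 'rV[R]_n) g :
  \det (edge_mx v) != 0 -> regular g ->
  (lebesgue_tuple R n).-integrable (@row_of_tuple R n @^-1` simplex v)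
    (EFin \o (g \o @row_of_tuple R n)).
Proof.
move=> hdet [mg bg]; have [B hB] := simplex_sub_cube v.
apply: measurable_bounded_integrable.
- exact: measurable_simplex.
- apply: le_lt_trans (lebesgue_cube_lty n B); apply: le_measure.
  + by rewrite inE; exact: measurable_simplex.
  + by rewrite inE; exact: measurable_cube.
  + by move=> t; exact: hB.
- exact: measurable_funTS.
- have [M hM] := bg B; exists M; split; first exact: num_real.
  by move=> N MN t /= /hB /hM /le_trans; apply; exact: ltW.
Qed.

Lemma volint_simplexD n (v : 'I_n.+1 -> 'rV[R]_n) f g :
  \det (edge_mx v) != 0 -> regular f -> regular g ->
  volint (simplex v) (fun x => f x + g x) =
  volint (simplex v) f + volint (simplex v) g.
Proof.
move=> hdet rf rg; apply: RintegralD; first exact: measurable_simplex.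
- exact: simplex_integrable.
- exact: simplex_integrable.
Qed.

Lemma volint_simplexZ n (v : 'I_n.+1 -> 'rV[R]_n) c f :
  \det (edge_mx v) != 0 -> regular f ->
  volint (simplex v) (fun x => c * f x) = c * volint (simplex v) f.
Proof.
move=> hdet rf; apply: RintegralZl; first exact: measurable_simplex.
exact: simplex_integrable.
Qed.

End volume_integral.

(** * Algebra of the conjugate transpose *)

Section conj_transpose.
Context {C : numClosedFieldType}.

Lemma conj_trmxM m n p (A : 'M[C]_(m, n)) (B : 'M[C]_(n, p)) :
  conj_trmx (A *m B) = conj_trmx B *m conj_trmx A.
Proof. by rewrite /conj_trmx trmx_mul map_mxM. Qed.

Lemma conj_trmxD m n (A B : 'M[C]_(m, n)) :
  conj_trmx (A + B) = conj_trmx A + conj_trmx B.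
Proof. by rewrite /conj_trmx linearD map_mxD. Qed.

Lemma conj_trmx0 m n : conj_trmx 0 = 0 :> 'M[C]_(m, n).
Proof. by rewrite /conj_trmx linear0 map_mx0. Qed.

Lemma conj_trmxN m n (A : 'M[C]_(m, n)) : conj_trmx (- A) = - conj_trmx A.
Proof. by rewrite /conj_trmx linearN map_mxN. Qed.

Lemma conj_trmx_sum m n (I : finType) (A : I -> 'M[C]_(m, n)) :
  conj_trmx (\sum_i A i) = \sum_i conj_trmx (A i).
Proof. by rewrite /conj_trmx !linear_sum map_mx_sum. Qed.

Lemma conj_trmxK m n (A : 'M[C]_(m, n)) : conj_trmx (conj_trmx A) = A.
Proof. by apply/matrixP => i j; rewrite !mxE conjCK. Qed.

End conj_transpose.

(** * Expansion of the squared Euclidean norm along a real line *)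

Section complex_norm.
Context {R : realType}.
Implicit Types z w : R[i].

Lemma ReD z w : complex.Re (z + w) = complex.Re z + complex.Re w.
Proof. by case: z w => [? ?] [? ?]. Qed.

Lemma Re_sum (I : Type) (r : seq I) (P : pred I) (F : I -> R[i]) :
  complex.Re (\sum_(i <- r | P i) F i) = \sum_(i <- r | P i) complex.Re (F i).
Proof. by apply: (big_morph _ ReD). Qed.

Lemma euclid_norm_sqrDZ q (r w : 'cV[R[i]]_q) (h : R) :
  euclid_norm (r + (h%:C)%C *: w) ^+ 2 =
  euclid_norm r ^+ 2 + 2 * h * complex.Re ((conj_trmx r *m w) 0 0) +
  h ^+ 2 * euclid_norm w ^+ 2.
Proof.
have ge0 (u : 'cV[R[i]]_q) :
    0 <= \sum_i (complex.Re (u i 0) ^+ 2 + complex.Im (u i 0) ^+ 2).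
  by rewrite sumr_ge0// => i _; rewrite addr_ge0 ?sqr_ge0.
rewrite /euclid_norm !sqr_sqrtr// mxE Re_sum !mulr_sumr -!big_split /=.
apply: eq_bigr => i _; rewrite !mxE.
case: (r i 0) (w i 0) => [a b] [c d] /=.
by rewrite !mul0r addr0 subr0; ring.
Qed.

End complex_norm.

(** For nonzero [h] the difference quotient is exactly [b + h * c], which tends to [b]; this gives
    both the existence and the value of the directional derivative. *)
Lemma is_derive_quadratic {R : realType} {V : normedModType R} (f : V -> R)
    (a v : V) (b c : R) :
  (forall h, f (h *: v + a) = f a + h * b + h ^+ 2 * c) -> is_derive a v f b.
Proof.
move=> fE.
have H : (fun h : R => h^-1 *: ((f \o shift a) (h *: v) - f a)) @ 0^' --> b.
  apply: (@cvg_trans _ ((fun h : R => b + h * c) @ 0^')).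
    apply: near_eq_cvg; near=> h.
    have h0 : h != 0 by near: h; exact: nbhs_dnbhs_neq.
    rewrite /= fE (_ : _ - f a = h * (b + h * c)); last by ring.
    by rewrite /GRing.scale /= mulKf.
  rewrite -[in nbhs b](addr0 b) -[X in nbhs (b + X)](mul0r c).
  apply: cvgD; first exact: cvg_cst.
  by apply: cvgM; [exact: cvg_within|exact: cvg_cst].
apply: DeriveDef; first by apply/cvg_ex; exists b.
exact: cvg_lim.
Unshelve. all: by end_near.
Qed.

(** * Superposition, uniqueness and duality for the discrete systems *)

Section hdg_theory.
Context {R : realType} {n : nat} {Omega : set 'rV[R]_n.+1}.
Context (T : mesh Omega) (Gabc Gd : set 'rV[R]_n.+1).
Context (bas : hdg_bases T) (med : medium T).
Local Notation C := R[i].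
Local Notation "r %:C" := (r%:C)%C : ring_scope.
Local Notation A_ := (A_ bas med).
Local Notation D_ := (D_ bas med).
Local Notation B_ := (B_ Gabc Gd bas med).
Local Notation L_ := (L_ Gabc Gd bas med).
Local Notation R_ := (R_ bas).
Local Notation hdg_solution := (hdg_solution Gabc Gd med).
Local Notation hdg_invertible := (hdg_invertible Gabc Gd bas med).
Implicit Types (e : elt T) (U V : vec C (state_dof bas)).

Lemma locDZ U V (a : C) e : loc (U + a *: V) e = loc U e + a *: loc V e.
Proof. by apply/matrixP => i j; rewrite !mxE /coef !mxE. Qed.

Lemma loc_eq0 U : (forall e, loc U e = 0) -> U = 0.
Proof.
move=> U0; apply/matrixP => i j; rewrite (ord1 j) mxE -(enum_valK i).
case: (enum_val i) => e k.
by have /matrixP/(_ (enum_rank k) 0) := U0 e; rewrite !mxE enum_rankK.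
Qed.

Lemma hdg_solutionDZ F F' U U' L L' (a : C) :
  hdg_solution F U L -> hdg_solution F' U' L' ->
  hdg_solution (fun e => F e + a *: F' e) (U + a *: U') (L + a *: L').
Proof.
move=> [h1 h2] [h1' h2']; split=> [e|].
  by rewrite -h1 -h1' locDZ !mulmxDr -!scalemxAr scalerDr addrACA.
transitivity (0 + a *: 0 : vec C (trace_dof bas)); last by rewrite scaler0 addr0.
transitivity (\sum_e (R_ e)^T *m (B_ e *m loc U e + L_ e *m (R_ e *m L)) +
  a *: \sum_e (R_ e)^T *m (B_ e *m loc U' e + L_ e *m (R_ e *m L')));
  last by rewrite h2 h2'.
rewrite scaler_sumr -big_split /=; apply: eq_bigr => e _.
by rewrite locDZ !mulmxDr -!scalemxAr scalerDr addrACA.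
Qed.

(** Static condensation: the element equations express the local unknowns through the trace, and
    substitution in the transmission condition leaves the global matrix [K_] applied to [L], so [L]
    vanishes, and then so does [U]. *)
Lemma hdg_solution_eq0 U L : hdg_invertible ->
  hdg_solution (fun=> 0) U L -> U = 0.
Proof.
move=> [uA uK] [h1 h2].
have locE e : loc U e = - (invmx (A_ e) *m (D_ e *m (R_ e *m L))).
  by rewrite -[LHS](mulKmx (uA e)) -mulmxN; congr (_ *m _); apply/eqP;
    rewrite -addr_eq0 h1.
have L0 : L = 0.
  rewrite -[L](mulKmx uK) -[RHS](mulmx0 _ (invmx (K_ Gabc Gd bas med))).
  congr (_ *m _); rewrite -h2 /K_ mulmx_suml; apply: eq_bigr => e _.
  rewrite locE -!mulmxA; congr (_ *m _).
  by rewrite mulmxBl mulmxN addrC !mulmxA.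
by apply: loc_eq0 => e; rewrite locE L0 !mulmx0 oppr0.
Qed.

Lemma hdg_solution_unique F U V LU LV : hdg_invertible ->
  hdg_solution F U LU -> hdg_solution F V LV -> U = V.
Proof.
move=> hinv hU hV; apply/eqP; rewrite -subr_eq0 -scaleN1r; apply/eqP.
apply: (hdg_solution_eq0 (L := LU + -1 *: LV) hinv).
have [h1 h2] := hdg_solutionDZ (-1) hU hV.
by split=> // e; rewrite h1 scaleN1r subrr.
Qed.

Lemma dot_eltE e (U V : vec C (elt_dof bas e)) :
  dot_elt U V = (conj_trmx V *m U) 0 0.
Proof.
rewrite /dot_elt pair_bigA mxE (reindex _ (onW_bij _ (enum_val_bij _))) /=.
apply: eq_bigr => i _; rewrite !mxE -surjective_pairing /coef enum_valK.
exact: mulrC.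
Qed.

(** A global degree of freedom is an element paired with a local one, so the matrix product over all
    of them splits element by element. *)
Lemma sum_elt_obs q (obs : 'M[C]_(q, #|state_dof bas|)) U :
  \sum_e elt_obs obs e *m loc U e = obs *m U.
Proof.
apply/matrixP => i j; rewrite (ord1 j) summxE mxE.
rewrite (reindex _ (onW_bij _ (enum_rank_bij _))) /=.
under eq_bigr do rewrite mxE.
rewrite (eq_bigr (fun e => \sum_(k : elt_dof bas e)
   obs i (enum_rank (Tagged (elt_dof bas) k)) *
   U (enum_rank (Tagged (elt_dof bas) k)) 0)).
  rewrite sig_big_dep /=; apply: eq_bigr => -[e k] _ //.
move=> e _; rewrite [RHS](reindex _ (onW_bij _ (enum_val_bij _))) /=.
by apply: eq_bigr => k _; rewrite !mxE.
Qed.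

Lemma conj_trmx_R e : conj_trmx (R_ e) = (R_ e)^T.
Proof. by apply/matrixP => i j; rewrite !mxE rmorph_nat. Qed.

(** Discrete duality: the direct equations are tested against [gam], and the conjugate-transposed
    adjoint equations move the matrices onto the adjoint state, leaving only the observation
    term. *)
Lemma adjoint_identity F U L q (obs : 'M[C]_(q, #|state_dof bas|)) res gam Gam :
  hdg_solution F U L -> adjoint_solution Gabc Gd med obs res gam Gam ->
  \sum_e conj_trmx (loc gam e) *m F e = - (conj_trmx res *m (obs *m U)).
Proof.
move=> [hU1 hU2] [hg1 hg2].
(* This is the conjugate transpose of the adjoint equation on [e]; the restriction matrices have
   entries 0 and 1, so conjugation does not change them. *)
have gA e : conj_trmx (loc gam e) *m A_ e =
    - (conj_trmx res *m elt_obs obs e) - conj_trmx Gam *m (R_ e)^T *m B_ e.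
  have := congr1 (@conj_trmx _ _ _) (hg1 e).
  rewrite conj_trmxD conj_trmxN !conj_trmxM !conj_trmxK conj_trmx_R.
  by move=> /(canRL (addrK _)).
(* The adjoint transmission condition holds only for the sum over elements, hence so does this
   identity. *)
have gD : \sum_e conj_trmx (loc gam e) *m D_ e *m R_ e =
    - \sum_e conj_trmx Gam *m (R_ e)^T *m L_ e *m R_ e.
  apply/eqP; rewrite -addr_eq0 -big_split /=; apply/eqP.
  have := congr1 (@conj_trmx _ _ _) hg2; rewrite conj_trmx_sum conj_trmx0 => h; rewrite -[RHS]h.
  apply: eq_bigr => e _; rewrite conj_trmxM conj_trmxD !conj_trmxM !conj_trmxK.
  by rewrite -(conj_trmx_R e) conj_trmxK mulmxDl.
under eq_bigr do rewrite -hU1 mulmxDr !mulmxA gA.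
rewrite big_split /= -mulmx_suml gD mulNmx mulmx_suml.
under eq_bigr do rewrite mulmxBl mulNmx -!mulmxA.
rewrite sumrB sumrN -mulmx_sumr sum_elt_obs -addrA -opprD -big_split /=.
(* The remaining terms, in [B_] and [L_], add up to [conj_trmx Gam] times the transmission condition
   of [U], hence to zero. *)
rewrite -[RHS]subr0; congr (_ - _).
rewrite -[RHS](mulmx0 _ (conj_trmx Gam)) -hU2 mulmx_sumr.
by apply: eq_bigr => e _; rewrite !mulmxDr !mulmxA.
Qed.

Lemma regular_hat_conj e (U : vec C (elt_dof bas e)) i :
  regular (fun x => complex.Re (hat_conj U i x)) /\
  regular (fun x => complex.Im (hat_conj U i x)).
Proof.
(* The basis is real-valued, so conjugation acts on the coefficients alone, and both parts are real
   combinations of polynomials. *)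
have -> : hat_conj U i = fun x =>
    ((\sum_k complex.Re (coef U (i, k)) * ebasis bas e k x) +i*
     (- \sum_k complex.Im (coef U (i, k)) * ebasis bas e k x))%C.
  apply/funext => x; rewrite /hat_conj /hat.
  have -> : \sum_k coef U (i, k) * (ebasis bas e k x)%:C =
      ((\sum_k complex.Re (coef U (i, k)) * ebasis bas e k x) +i*
       (\sum_k complex.Im (coef U (i, k)) * ebasis bas e k x))%C.
    elim/big_rec3 : _ => // k a b c _ ->.
    by case: (coef U (i, k)) => u v; apply/eqP; rewrite eq_complex /= !mulr0 subr0 add0r !eqxx.
  by [].
split => /=; last under eq_fun do rewrite -mulN1r.
all: try (apply: regularM; first exact: regular_cst).
all: apply: regular_sum => k; apply: regularM; first exact: regular_cst.
all: apply: regular_poly_fun; exact: lag_poly.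
Qed.

Lemma regular_hat_source (S : vec R (source_dof bas)) e : regular (hat_source S e).
Proof.
apply: regular_sum => k; apply: regularM; first exact: regular_cst.
apply: regular_poly_fun; exact: lag_poly.
Qed.

(** The source enters the integrand linearly and [h] is real, so the real and imaginary integrals
    split separately; the splitting rests on the integrability of each piece. *)
Lemma M_hat_sourceDZ e (U : vec C (elt_dof bas e)) (S S' : vec R (source_dof bas)) (h : R) :
  M_ bas e (hat_conj U) (hat_source (S + h *: S') e) =
  M_ bas e (hat_conj U) (hat_source S e) +
  h%:C *: M_ bas e (hat_conj U) (hat_source S' e).
Proof.
apply/matrixP => r j; rewrite !mxE; case: ifP => _; last by rewrite mulr0 addr0.
set phi := ebasis bas e _; set u := hat_conj U None.
have [rRe rIm] := regular_hat_conj U None.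
have rphi : regular phi by apply: regular_poly_fun; exact: lag_poly.
have hatD x : hat_source (S + h *: S') e x = hat_source S e x + h * hat_source S' e x.
  rewrite /hat_source mulr_sumr -big_split /=; apply: eq_bigr => k _.
  by rewrite /coef !mxE mulrDl mulrA.
have intD (g : 'rV[R]_n.+1 -> R) : regular g ->
    int_elt e (fun x => hat_source (S + h *: S') e x * g x * phi x) =
    int_elt e (fun x => hat_source S e x * g x * phi x) +
    h * int_elt e (fun x => hat_source S' e x * g x * phi x).
  move=> rg; rewrite /int_elt.
  have rs (s : vec R (source_dof bas)) :
      regular (fun x => hat_source s e x * g x * phi x).
    by apply: regularM => //; apply: regularM => //; exact: regular_hat_source.
  rewrite -volint_simplexZ//; last exact: evtx_nondegenerate.
  rewrite -volint_simplexD//; [|exact: evtx_nondegenerate|].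
    by congr volint; apply/funext => x; rewrite hatD !mulrDl !mulrA.
  by apply: regularM => //; exact: regular_cst.
have int_eltCE s : int_eltC e (fun x => (hat_source s e x)%:C * u x * (phi x)%:C) =
    (int_elt e (fun x => hat_source s e x * complex.Re (u x) * phi x) +i*
     int_elt e (fun x => hat_source s e x * complex.Im (u x) * phi x))%C.
  congr (_ +i* _)%C; congr int_elt; apply/funext => x; case: (u x) => a b /=.
    by rewrite !mul0r !mulr0 !subr0.
  by rewrite !mul0r !mulr0 addr0 add0r.
rewrite !int_eltCE !intD//.
by apply/eqP; rewrite eq_complex /= !mul0r subr0 addr0 !eqxx.
Qed.

End hdg_theory.

Unset Implicit Arguments.

(** * Derivative of the misfit through the adjoint state *)

Theorem mainTheorem1 (R : realType) (n : nat) (hd : n.+1 = 2%N \/ n.+1 = 3%N)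
  (Omega Gabc Gd : set 'rV[R]_n.+1) (hOmega : bounded_domain Omega)
  (T : mesh Omega) (hGamma : boundary_split T Gabc Gd)
  (bas : hdg_bases T) (med : medium T)
  (hinv : hdg_invertible Gabc Gd bas med)
  (x2 : 'rV[R]_n.+1) (q : nat)
  (obs : 'M[R[i]]_(q, #|state_dof bas|)) (dat : 'cV[R[i]]_q)
  (G : vec R[i] (state_dof bas)) (LG : vec R[i] (trace_dof bas))
  (hG : green_solution Gabc Gd med x2 G LG)
  (Csol : vec R (source_dof bas) -> vec R[i] (state_dof bas))
  (LCsol : vec R (source_dof bas) -> vec R[i] (trace_dof bas))
  (hC : forall S, correlation_solution Gabc Gd med G S (Csol S) (LCsol S))
  (S : vec R (source_dof bas))
  (gam2 : vec R[i] (state_dof bas)) (Gam2 : vec R[i] (trace_dof bas))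
  (hgam : adjoint_solution Gabc Gd med obs (obs *m Csol S - dat) gam2 Gam2)
  (delta : vec R (source_dof bas)) :
  is_derive S delta (fun S' => misfit obs dat (Csol S'))
    (- complex.Re (\sum_(e : elt T)
         dot_elt (M_ bas e (hat_conj (loc G e)) (hat_source delta e)) (loc gam2 e))).
Proof.
(* [Csol] is only given as some solution for each source; superposition yields a second solution for
   the perturbed source, and uniqueness identifies the two. *)
have CsolDZ h : Csol (h *: delta + S) = Csol S + (h%:C)%C *: Csol delta.
  have [sol1 sol2] := hdg_solutionDZ (h%:C)%C (hC S) (hC delta).
  rewrite addrC; apply: (hdg_solution_unique hinv (hC _) (LV := LCsol S + (h%:C)%C *: LCsol delta)).
  by split=> [e|]; [rewrite sol1 -M_hat_sourceDZ|exact: sol2].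
(* Duality applied to [Csol delta] turns the adjoint expression into the cross term of the expanded
   square; its minus sign cancels the one in front of the real part. *)
have -> : - complex.Re (\sum_e dot_elt
      (M_ bas e (hat_conj (loc G e)) (hat_source delta e)) (loc gam2 e)) =
    complex.Re ((conj_trmx (obs *m Csol S - dat) *m (obs *m Csol delta)) 0 0).
  under eq_bigr do rewrite dot_eltE.
  rewrite -summxE (adjoint_identity (hC delta) hgam) mxE.
  by case: (_ 0 0) => a b /=; rewrite opprK.
(* The factor one half in the misfit cancels the 2 of the cross term and remains in the quadratic
   coefficient. *)
apply: (is_derive_quadratic (c := 2^-1 * euclid_norm (obs *m Csol delta) ^+ 2)) => h.
rewrite /misfit CsolDZ mulmxDr -scalemxAr addrAC euclid_norm_sqrDZ.
by field.
Qed.
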